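(* Consider the deterministic OGDA method or the deterministic EG method with an arbitrary choice of learning rates $\eta_x,\eta_y>0$, and let $\bar x$ be the returned solution after $T$ iterations. There is a constant $c>0$ depending only on $\ell$ (in particular not on the learning rates, $\kappa$, the gap or $\epsilon$) such that for all $\ell\ge\mu>0$, with $\kappa=\ell/\mu$, every $\Delta>0$, each of the two methods, every choice of learning rates and all sufficiently small $\epsilon>0$ there exist an $\ell$-smooth function $f$ with $f(x,\cdot)$ $\mu$-strongly concave for every $x$, and an initialization $(x_0,y_0)$ with $\Delta_\Phi=\Delta$, such that $\|\nabla\Phi(\bar x)\|\le\epsilon$ implies $$T\ \ge\ c\,\frac{\kappa\,\Delta_\Phi}{\epsilon^2}.$$ (That is, OGDA/EG requires at least $T=\Omega(\kappa\Delta_\Phi/\epsilon^2)$ iterations to guarantee $\|\nabla\Phi(\bar x)\|\le\epsilon$.)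
   Context: $f$ is $\ell$-smooth if it is differentiable and $\|\nabla f(x_1,y_1)-\nabla f(x_2,y_2)\|^2\le \ell^2\|x_1-x_2\|^2+\ell^2\|y_1-y_2\|^2$. $\Phi(x)=\max_yf(x,y)$, and $\Delta_\Phi=\max(\Phi(x_1),\Phi(x_0))-\min_x\Phi(x)$. The dual variable is unconstrained. OGDA (with $(x_{-1},y_{-1})=(x_0,y_0)$), $t\ge 0$: $x_{t+1}=x_t-\eta_x\nabla_xf(x_t,y_t)-\eta_x(\nabla_xf(x_t,y_t)-\nabla_xf(x_{t-1},y_{t-1}))$, $y_{t+1}=y_t+\eta_y\nabla_yf(x_t,y_t)+\eta_y(\nabla_yf(x_t,y_t)-\nabla_yf(x_{t-1},y_{t-1}))$. EG, $t\ge0$: $x_{t+1/2}=x_t-\eta_x\nabla_xf(x_t,y_t)$, $y_{t+1/2}=y_t+\eta_y\nabla_yf(x_t,y_t)$, $x_{t+1}=x_t-\eta_x\nabla_xf(x_{t+1/2},y_{t+1/2})$, $y_{t+1}=y_t+\eta_y\nabla_yf(x_{t+1/2},y_{t+1/2})$. The returned $\bar x$ is chosen at random from $x_1,\dots,x_T$. The function $f$ may depend on the learning rates and on $\epsilon$. *)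

(* Defs.v *)
From HB Require Import structures.
From mathcomp Require Import all_boot all_order all_algebra.
From mathcomp Require Import all_classical all_reals all_analysis.

Set Implicit Arguments.
Unset Strict Implicit.
Unset Printing Implicit Defensive.

Import Order.TTheory GRing.Theory Num.Theory.
Import numFieldNormedType.Exports.

Local Open Scope classical_set_scope.
Local Open Scope ring_scope.

(* The library norm on 'rV[R]_n is the sup norm; it is only used through the
   topology (differentiability).  All norms of the statement are Euclidean. *)
Definition sqnorm (R : realType) (n : nat) (v : 'rV[R]_n) : R :=
  \sum_i v 0 i ^+ 2.

Definition enorm (R : realType) (n : nat) (v : 'rV[R]_n) : R :=
  Num.sqrt (sqnorm v).

Definition grad (R : realType) (n : nat) (F : 'rV[R]_n -> R) (x : 'rV[R]_n) :
    'rV[R]_n :=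
  \row_i 'D_(delta_mx 0 i) F x.

Definition grad_x (R : realType) (m n : nat) (f : 'rV[R]_m -> 'rV[R]_n -> R)
    (z : 'rV[R]_m * 'rV[R]_n) : 'rV[R]_m :=
  grad (fun x => f x z.2) z.1.

Definition grad_y (R : realType) (m n : nat) (f : 'rV[R]_m -> 'rV[R]_n -> R)
    (z : 'rV[R]_m * 'rV[R]_n) : 'rV[R]_n :=
  grad (f z.1) z.2.

(* The left-hand side of the inequality is the squared norm of the difference
   of the full gradients, split into its two blocks. *)
Definition smooth (R : realType) (m n : nat) (l : R)
    (f : 'rV[R]_m -> 'rV[R]_n -> R) : Prop :=
  (forall z : 'rV[R]_m * 'rV[R]_n,
     differentiable (fun w : 'rV[R]_m * 'rV[R]_n => f w.1 w.2) z) /\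
  (forall z1 z2 : 'rV[R]_m * 'rV[R]_n,
     sqnorm (grad_x f z1 - grad_x f z2) + sqnorm (grad_y f z1 - grad_y f z2)
     <= l ^+ 2 * sqnorm (z1.1 - z2.1) + l ^+ 2 * sqnorm (z1.2 - z2.2)).

Definition strongly_concave (R : realType) (n : nat) (mu : R)
    (g : 'rV[R]_n -> R) : Prop :=
  forall (y1 y2 : 'rV[R]_n) (s : R), 0 <= s -> s <= 1 ->
    s * g y1 + (1 - s) * g y2 + mu / 2 * (s * (1 - s)) * sqnorm (y1 - y2)
    <= g (s *: y1 + (1 - s) *: y2).

(* The supremum is a maximum whenever [f x] is differentiable and strongly
   concave. *)
Definition Phi (R : realType) (m n : nat) (f : 'rV[R]_m -> 'rV[R]_n -> R)
    (x : 'rV[R]_m) : R :=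
  sup (range (f x)).

(* [D] is the gap of [F] for the points [x0] and [x1].  It is a relation so
   that the minimum of [F] is required to exist: [inf] of a set that is
   unbounded below is a junk value. *)
Definition is_gap (R : realType) (m : nat) (F : 'rV[R]_m -> R)
    (x0 x1 : 'rV[R]_m) (D : R) : Prop :=
  exists xmin : 'rV[R]_m,
    (forall x, F xmin <= F x) /\ D = Num.max (F x1) (F x0) - F xmin.

Inductive method := OGDA | EG.

Definition ogda_step (R : realType) (m n : nat)
    (f : 'rV[R]_m -> 'rV[R]_n -> R) (etax etay : R)
    (zprev z : 'rV[R]_m * 'rV[R]_n) : 'rV[R]_m * 'rV[R]_n :=
  (z.1 - etax *: grad_x f z - etax *: (grad_x f z - grad_x f zprev),
   z.2 + etay *: grad_y f z + etay *: (grad_y f z - grad_y f zprev)).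

(* The pair (z_{t-1}, z_t), with z_{-1} = z_0. *)
Fixpoint ogda_pair (R : realType) (m n : nat)
    (f : 'rV[R]_m -> 'rV[R]_n -> R) (etax etay : R)
    (z0 : 'rV[R]_m * 'rV[R]_n) (t : nat) :
    ('rV[R]_m * 'rV[R]_n) * ('rV[R]_m * 'rV[R]_n) :=
  if t is t'.+1 then
    let p := ogda_pair f etax etay z0 t' in
    (p.2, ogda_step f etax etay p.1 p.2)
  else (z0, z0).

Definition eg_step (R : realType) (m n : nat)
    (f : 'rV[R]_m -> 'rV[R]_n -> R) (etax etay : R)
    (z : 'rV[R]_m * 'rV[R]_n) : 'rV[R]_m * 'rV[R]_n :=
  let zhalf := (z.1 - etax *: grad_x f z, z.2 + etay *: grad_y f z) in
  (z.1 - etax *: grad_x f zhalf, z.2 + etay *: grad_y f zhalf).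

Definition iterate (R : realType) (m n : nat) (alg : method)
    (f : 'rV[R]_m -> 'rV[R]_n -> R) (etax etay : R)
    (x0 : 'rV[R]_m) (y0 : 'rV[R]_n) (t : nat) : 'rV[R]_m * 'rV[R]_n :=
  match alg with
  | OGDA => (ogda_pair f etax etay (x0, y0) t).2
  | EG => iter t (eg_step f etax etay) (x0, y0)
  end.

(* [xbar] is a possible outcome of the random choice among x_1, ..., x_T. *)
Definition returned (R : realType) (m : nat) (xs : nat -> 'rV[R]_m) (T : nat)
    (xbar : 'rV[R]_m) : Prop :=
  exists2 t : nat, (1 <= t <= T)%N & xbar = xs t.

(* Main.v *)
(* One-dimensional instances f(x, y) = g(x) + b x y - c y^2 / 2 suffice.  For
   quadratic g both methods leave an eigenline of the linear update invariant,
   and along an eigenvalue lam of (etax f_xx, etax f_xy; -etay f_xy, -etay f_yy)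
   with lam < 0 or lam >= 2 the primal iterate never shrinks, although Phi is
   strongly convex.  Such an f exists if etax >= 2 / l and, when kappa >= 4,
   also if etay > 4 / l or if etay <= kappa etax / 4.  In all remaining cases
   etax <= 16 / (kappa l); then g(x) = Delta sin(2 eps x / Delta) has slope at
   most 2 eps and curvature of order eps^2 / Delta, so from x = 0 a method
   moving O(etax eps) per step has to travel a distance Delta / (4 eps) before
   |Phi'| drops to eps. *)
Require Import Defs.
From HB Require Import structures.
From mathcomp Require Import all_boot all_order all_algebra.
From mathcomp Require Import all_classical all_reals all_analysis.
From mathcomp Require Import ring lra.

Import Order.TTheory GRing.Theory Num.Theory.
Import numFieldNormedType.Exports.

Local Open Scope ring_scope.

(** * Scalar instances with quadratic dual part: gradients, smoothness, primal function *)

Section OneDimensional.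
Variable R : realType.
Implicit Types (g dg : R -> R) (x y : 'rV[R]_1).

Lemma grad_entry (h : R -> R) x (d : R) :
  is_derive (x 0 0) 1 h d -> grad (fun v => h (v 0 0)) x = const_mx d.
Proof.
move=> [_ <-]; apply/rowP => i; rewrite ord1 !mxE /derive.
under eq_fun => k do rewrite /= !mxE eqxx.
by [].
Qed.

Lemma sqnorm1 x : sqnorm x = x 0 0 ^+ 2.
Proof. by rewrite /sqnorm big_ord1. Qed.

Lemma enorm1 x : enorm x = `|x 0 0|.
Proof. by rewrite /enorm sqnorm1 sqrtr_sqr. Qed.

Definition coupled g (b c : R) : 'rV[R]_1 -> 'rV[R]_1 -> R :=
  fun x y => g (x 0 0) + b * x 0 0 * y 0 0 - c / 2 * y 0 0 ^+ 2.

Section Coupled.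
Variables (g dg : R -> R) (b c : R).
Hypothesis dgE : forall u : R, is_derive u 1 g (dg u).

Lemma grad_x_coupled z :
  grad_x (coupled g b c) z = const_mx (dg (z.1 0 0) + b * z.2 0 0).
Proof.
apply: (grad_entry (fun u => g u + b * u * z.2 0 0 - c / 2 * z.2 0 0 ^+ 2)).
have := dgE (z.1 0 0) => dgz.
apply: is_derive_eq; rewrite /GRing.scale /=; ring.
Qed.

Lemma grad_y_coupled z :
  grad_y (coupled g b c) z = const_mx (b * z.1 0 0 - c * z.2 0 0).
Proof.
apply: (grad_entry (fun v => g (z.1 0 0) + b * z.1 0 0 * v - c / 2 * v ^+ 2)).
by apply: is_derive_eq; rewrite /GRing.scale /=; field.
Qed.

Lemma differentiable_coupled (z : 'rV[R]_1 * 'rV[R]_1) :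
  differentiable (fun w : 'rV[R]_1 * 'rV[R]_1 => coupled g b c w.1 w.2) z.
Proof.
have d1 : differentiable (fun w : 'rV[R]_1 * 'rV[R]_1 => w.1 0 0) z.
  apply: (@differentiable_comp _ _ _ _ fst (fun v : 'rV[R]_1 => v 0 0)).
    by apply: linear_differentiable => t; exact: cvg_fst.
  exact: differentiable_coord.
have d2 : differentiable (fun w : 'rV[R]_1 * 'rV[R]_1 => w.2 0 0) z.
  apply: (@differentiable_comp _ _ _ _ snd (fun v : 'rV[R]_1 => v 0 0)).
    by apply: linear_differentiable => t; exact: cvg_snd.
  exact: differentiable_coord.
apply: differentiableB; last first.
  apply: differentiableM; first exact: differentiable_cst.
  by under eq_fun do rewrite expr2; exact: differentiableM.
apply: differentiableD; last first.
  apply: differentiableM => //.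
  by apply: differentiableM => //; exact: differentiable_cst.
apply: (@differentiable_comp _ _ _ _ (fun w : 'rV[R]_1 * 'rV[R]_1 => w.1 0 0) g)
  => //.
by apply/derivable1_diffP; apply: ex_derive; exact: dgE.
Qed.

Lemma smooth_coupled (l : R) :
  (forall u1 u2 v1 v2 : R,
     (dg u1 - dg u2 + b * (v1 - v2)) ^+ 2 + (b * (u1 - u2) - c * (v1 - v2)) ^+ 2
     <= l ^+ 2 * (u1 - u2) ^+ 2 + l ^+ 2 * (v1 - v2) ^+ 2) ->
  smooth l (coupled g b c).
Proof.
move=> lip; split=> [|z1 z2]; first exact: differentiable_coupled.
rewrite !grad_x_coupled !grad_y_coupled !sqnorm1 !mxE.
apply: le_trans (lip (z1.1 0 0) (z2.1 0 0) (z1.2 0 0) (z2.2 0 0)).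
rewrite le_eqVlt; apply/orP; left; apply/eqP; ring.
Qed.

Lemma strongly_concave_coupled (mu : R) x :
  mu <= c -> strongly_concave mu (coupled g b c x).
Proof.
move=> muc y1 y2 s s0 s1; rewrite sqnorm1 /coupled !mxE -subr_ge0.
(* For a quadratic the concavity defect is exact, so only the surplus modulus [c - mu] remains; [p]
   stands for [g (x 0 0)]. *)
have -> : forall p v w : R,
   p + b * x 0 0 * (s * v + (1 - s) * w) - c / 2 * (s * v + (1 - s) * w) ^+ 2
   - (s * (p + b * x 0 0 * v - c / 2 * v ^+ 2)
      + (1 - s) * (p + b * x 0 0 * w - c / 2 * w ^+ 2)
      + mu / 2 * (s * (1 - s)) * (v - w) ^+ 2)
   = (c - mu) / 2 * (s * (1 - s)) * (v - w) ^+ 2 by move=> *; field.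
rewrite mulr_ge0 ?sqr_ge0 // mulr_ge0 //; last by rewrite mulr_ge0 ?subr_ge0.
by rewrite divr_ge0 ?subr_ge0.
Qed.

Hypothesis c0 : 0 < c.

Lemma Phi_coupled x :
  Phi (coupled g b c) x = g (x 0 0) + b ^+ 2 / (2 * c) * x 0 0 ^+ 2.
Proof.
(* The maximizer in y; completing the square around it shows optimality. *)
pose yb := const_mx (b * x 0 0 / c) : 'rV[R]_1.
have c_neq0 : c != 0 by rewrite gt_eqF.
have E : coupled g b c x yb = g (x 0 0) + b ^+ 2 / (2 * c) * x 0 0 ^+ 2.
  by rewrite /coupled mxE; field.
have ub : ubound (range (coupled g b c x)) (coupled g b c x yb).
  move=> _ [y _ <-]; rewrite -subr_ge0.
  have -> : coupled g b c x yb - coupled g b c x y =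
            c / 2 * (y 0 0 - b * x 0 0 / c) ^+ 2.
    by rewrite /coupled mxE; field.
  by rewrite mulr_ge0 ?sqr_ge0 ?divr_ge0 ?ltW ?ltr0n.
rewrite -E /Phi; apply/eqP; rewrite eq_le; apply/andP; split.
  by apply: ge_sup => //; exists (coupled g b c x yb), yb.
by apply: ub_le_sup; [exists (coupled g b c x yb)|exists yb].
Qed.

Lemma grad_Phi_coupled x :
  grad (Phi (coupled g b c)) x = const_mx (dg (x 0 0) + b ^+ 2 / c * x 0 0).
Proof.
rewrite (_ : Phi _ = fun v => g (v 0 0) + b ^+ 2 / (2 * c) * v 0 0 ^+ 2);
  last by apply/funext => v; exact: Phi_coupled.
apply: (grad_entry (fun u => g u + b ^+ 2 / (2 * c) * u ^+ 2)).
have := dgE (x 0 0) => dgx.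
have c_neq0 : c != 0 by rewrite gt_eqF.
by by apply: is_derive_eq; rewrite /GRing.scale /=; field.
Qed.

End Coupled.

Lemma is_gap_entry (F : 'rV[R]_1 -> R) (G : R -> R) (u u0 u1 D : R) :
  (forall v, F v = G (v 0 0)) -> (forall v, G u <= G v) ->
  D = Num.max (G u1) (G u0) - G u ->
  is_gap F (const_mx u0) (const_mx u1) D.
Proof.
by move=> FG Gmin DE; exists (const_mx u); split=> [v|]; rewrite !FG ?mxE.
Qed.

End OneDimensional.

Section LowerBound.
Variable R : realType.
Implicit Types (f : 'rV[R]_1 -> 'rV[R]_1 -> R) (alg : method).

(** The bound [N] is a parameter because the drift argument supplies one finite value, whereas the
    eigenline argument allows every value. *)
Definition hard_instance (l mu D etax etay eps N : R) alg : Prop :=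
  exists (f : 'rV[R]_1 -> 'rV[R]_1 -> R) (x0 y0 : 'rV[R]_1),
    let x := fun t : nat => (iterate alg f etax etay x0 y0 t).1 in
    [/\ smooth l f,
        forall u, strongly_concave mu (f u),
        is_gap (Phi f) (x 0%N) (x 1%N) D &
        forall t : nat, enorm (grad (Phi f) (x t)) <= eps -> N <= t%:R].

(** * Quadratic instances whose iterates stay on an eigenline *)

Section Eigenline.
Variables (a b c q lam etax etay : R).
(** Together with [eigy]: (1, q) is an eigenvector, for the eigenvalue [lam], of the matrix of the
    linear update. *)
Hypothesis eigx : etax * (a + b * q) = lam.
Hypothesis eigy : etay * (c * q - b) = lam * q.

Let f := coupled R (fun u => a / 2 * u ^+ 2) b c.
Let ray (r : R) : 'rV[R]_1 * 'rV[R]_1 := (const_mx r, const_mx (q * r)).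

Lemma is_derive_half_square (u : R) :
  is_derive u 1 (fun v : R => a / 2 * v ^+ 2) (a * u).
Proof. by apply: is_derive_eq; rewrite /GRing.scale /=; field. Qed.

Lemma ray_step_x r : etax *: grad_x f (ray r) = const_mx (lam * r).
Proof.
rewrite (grad_x_coupled _ _ _ _ _ is_derive_half_square).
by apply/rowP => i; rewrite !mxE -eigx; ring.
Qed.

Lemma ray_step_y r : etay *: grad_y f (ray r) = const_mx (- (q * (lam * r))).
Proof.
rewrite grad_y_coupled; apply/rowP => i; rewrite !mxE.
transitivity (- (lam * q * r)); last by ring.
rewrite -eigy; ring.
Qed.

Lemma eg_step_ray r : eg_step f etax etay (ray r) = ray ((1 - lam + lam ^+ 2) * r).
Proof.
rewrite /eg_step ray_step_x ray_step_y.
have -> : ((ray r).1 - const_mx (lam * r), (ray r).2 + const_mx (- (q * (lam * r))))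
          = ray ((1 - lam) * r).
  by congr pair; apply/rowP => i; rewrite !mxE; ring.
rewrite ray_step_x ray_step_y.
by congr pair; apply/rowP => i; rewrite !mxE; ring.
Qed.

Lemma ogda_step_ray r' r :
  ogda_step f etax etay (ray r') (ray r) = ray ((1 - 2 * lam) * r + lam * r').
Proof.
rewrite /ogda_step !scalerBr !ray_step_x !ray_step_y.
by congr pair; apply/rowP => i; rewrite !mxE; ring.
Qed.

Hypothesis lam_out : lam < 0 \/ 2 <= lam.

(* [theta] is the ratio of two consecutive iterates; a further step multiplies
   by [1 - 2 * lam + lam * theta], which is at least 1 or at most -1. *)
Lemma ogda_pair_ray (t : nat) r : exists w theta : R,
  [/\ ogda_pair f etax etay (ray r) t = (ray (theta * w * r), ray (w * r)),
      1 <= `|w| &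
      theta = 1 \/ (lam < 0 /\ 0 <= theta <= 1) \/ (2 <= lam /\ -1 <= theta <= 0)].
Proof.
elim: t => [|t [w [theta [E w1 theta_in]]]].
  (* The convention z_{-1} = z_0 makes the initial ratio 1. *)
  by exists 1, 1; rewrite !mul1r normr1; split => //; left.
pose m := 1 - 2 * lam + lam * theta.
have m_out : (lam < 0 /\ 1 <= m) \/ (2 <= lam /\ m <= -1).
  rewrite /m; case: theta_in => [->|[[? /andP[? ?]]|[? /andP[? ?]]]].
  - by case: lam_out => ?; [left|right]; split=> //; lra.
  - by left; split=> //; nra.
  - by right; split=> //; nra.
have m_neq0 : m != 0.
  by case: m_out => -[_ mle]; [rewrite gt_eqF|rewrite lt_eqF] => //; lra.
have m1 : 1 <= `|m|.
  by case: m_out => -[_ mle]; rewrite ler_normr; apply/orP; [left|right]; lra.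
exists (m * w), m^-1; rewrite /= E /= ogda_step_ray; split.
- by rewrite mulKf //; congr (_, ray _); rewrite /m; ring.
- by rewrite normrM -[1]mulr1 ler_pM.
- right; case: m_out => -[lam_in mle]; [left|right]; split=> //; apply/andP; split.
  + by rewrite invr_ge0; lra.
  + by rewrite invf_le1 //; lra.
  + have -> : m^-1 = - (- m)^-1 by rewrite invrN opprK.
    by rewrite lerN2 invf_le1; lra.
  + by rewrite invr_le0; lra.
Qed.

Lemma iterate_ray alg (t : nat) r : exists2 w, 1 <= `|w| &
  iterate alg f etax etay (ray r).1 (ray r).2 t = ray (w * r).
Proof.
case: alg => /=.
  by have [w [theta [E w1 _]]] := ogda_pair_ray t r; exists w; rewrite // E.
elim: t => [|t [w w1 /= ->]]; first by exists 1; rewrite ?normr1 // mul1r.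
exists ((1 - lam + lam ^+ 2) * w); last by rewrite eg_step_ray mulrA.
rewrite normrM -[1]mulr1 ler_pM // ler_normr; apply/orP; left.
(* The EG factor is 1 + lam (lam - 1), and lam (lam - 1) >= 0 on both ranges. *)
by case: lam_out; nra.
Qed.

(** The gap involves x_1, so the first step is needed exactly. For OGDA it is a plain gradient step,
    since z_{-1} = z_0. *)
Definition first_factor alg : R :=
  if alg is OGDA then 1 - lam else 1 - lam + lam ^+ 2.

Lemma iterate1_ray alg r :
  iterate alg f etax etay (ray r).1 (ray r).2 1 = ray (first_factor alg * r).
Proof.
case: alg => /=; last by rewrite eg_step_ray.
by rewrite -[(_, const_mx _)]/(ray r) ogda_step_ray; congr ray; ring.
Qed.

(** This places the maximum in the gap at x_1. *)
Lemma first_factor_ge1 alg : 1 <= first_factor alg ^+ 2.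
Proof. by case: alg lam_out => /= [] []; nra. Qed.

(** Here Phi(x) = H x^2 / 2 with H = a + b^2 / c > 0. No iterate is closer to 0 than the starting
    point r, so the slope of Phi never falls below [H * r], and a smaller tolerance is never met. *)
Lemma hard_instance_ray alg (l mu D : R) :
  0 < mu -> mu <= c -> 0 < a + b ^+ 2 / c -> 0 < D ->
  (forall u v : R, (a * u + b * v) ^+ 2 + (b * u - c * v) ^+ 2
     <= l ^+ 2 * u ^+ 2 + l ^+ 2 * v ^+ 2) ->
  exists2 eps0 : R, 0 < eps0 &
  forall eps N : R, eps < eps0 -> hard_instance l mu D etax etay eps N alg.
Proof.
move=> mu0 muc H0 D0 lip.
have c0 : 0 < c by exact: lt_le_trans muc.
have c_neq0 : c != 0 by rewrite gt_eqF.
set H := a + b ^+ 2 / c in H0.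
pose k := first_factor alg; have k1 : 1 <= k ^+ 2 := first_factor_ge1 alg.
have k2_gt0 : 0 < k ^+ 2 by exact: lt_le_trans k1.
have k_neq0 : k != 0 by rewrite -sqrf_eq0 gt_eqF.
have H_neq0 : H != 0 by rewrite gt_eqF.
(* Solves H (k r)^2 / 2 = D, where k r is the point x_1. *)
pose r := Num.sqrt (2 * D / (H * k ^+ 2)).
have q0 : 0 < 2 * D / (H * k ^+ 2) by apply: divr_gt0; apply: mulr_gt0; rewrite ?ltr0n.
have r0 : 0 < r by rewrite sqrtr_gt0.
have r2 : r ^+ 2 = 2 * D / (H * k ^+ 2) by rewrite sqr_sqrtr // ltW.
exists (H * r) => [|eps N epslt]; first by rewrite mulr_gt0.
exists f, (ray r).1, (ray r).2 => x; split.
- apply: (smooth_coupled _ _ _ _ _ is_derive_half_square) => u1 u2 v1 v2.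
  by rewrite -mulrBr; exact: lip.
- by move=> u; exact: strongly_concave_coupled.
- rewrite {}/x iterate1_ray [iterate _ _ _ _ _ _ 0](_ : _ = ray r); last by case: (alg).
  apply: (is_gap_entry _ _ (fun v => H / 2 * v ^+ 2) 0) => [v|v|].
  + by rewrite Phi_coupled // /H; field.
  + by rewrite expr0n mulr0 mulr_ge0 ?sqr_ge0 ?divr_ge0 ?ltW ?ltr0n.
  + rewrite expr0n mulr0 subr0 max_l; last first.
      by rewrite ler_pM2l ?divr_gt0 ?ltr0n // exprMn ler_peMl ?sqr_ge0.
    rewrite exprMn r2 -/k; field.
    by rewrite H_neq0 k_neq0.
- move=> t; rewrite {}/x.
  have [w w1 ->] := iterate_ray alg t r.
  rewrite (grad_Phi_coupled _ _ _ _ _ is_derive_half_square c0) enorm1 !mxE.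
  have -> : a * (w * r) + b ^+ 2 / c * (w * r) = w * (H * r) by rewrite /H; ring.
  rewrite normrM (gtr0_norm (mulr_gt0 H0 r0)) => le_eps.
  suff : H * r < H * r by rewrite ltxx.
  apply: le_lt_trans epslt; apply: le_trans le_eps.
  by rewrite ler_peMl // ltW // mulr_gt0.
Qed.

End Eigenline.

(** * Slow travel on an uncoupled sine-shaped instance *)

Section Drift.
Variables (g dg : R -> R) (c K etax etay : R).
Hypothesis dgE : forall u : R, is_derive u 1 g (dg u).
Hypothesis dg_le : forall u, `|dg u| <= K.
Hypothesis etax0 : 0 < etax.

Let f := coupled R g 0 c.

Lemma grad_x_uncoupled z : grad_x f z = const_mx (dg (z.1 0 0)).
Proof. by rewrite (grad_x_coupled _ _ _ _ _ dgE) mul0r addr0. Qed.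

(** EG moves by at most [K * etax]; the factor 3 is the one OGDA needs, whose step is etax (2 p -
    p') with |p|, |p'| <= K. *)
Lemma eg_step_drift z :
  `|(eg_step f etax etay z).1 0 0 - z.1 0 0| <= 3 * K * etax.
Proof.
rewrite /eg_step /= grad_x_uncoupled !mxE addrAC subrr add0r normrN normrM.
rewrite (gtr0_norm etax0) mulrC ler_pM2r //.
by apply: le_trans (dg_le _) _; have := le_trans (normr_ge0 _) (dg_le 0); lra.
Qed.

Lemma ogda_step_drift z' z :
  `|(ogda_step f etax etay z' z).1 0 0 - z.1 0 0| <= 3 * K * etax.
Proof.
rewrite /ogda_step /= !grad_x_uncoupled !mxE.
set p := dg _; set p' := dg _.
have -> : z.1 0 0 - etax * p - etax * (p - p') - z.1 0 0 = (p' - 2 * p) * etax.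
  by ring.
rewrite normrM (gtr0_norm etax0) ler_pM2r //.
have := dg_le (z.1 0 0); have := dg_le (z'.1 0 0); rewrite -/p -/p'.
by rewrite !ler_norml => /andP[? ?] /andP[? ?]; apply/andP; split; lra.
Qed.

Lemma iterate_drift alg x0 y0 (t : nat) :
  `|(iterate alg f etax etay x0 y0 t).1 0 0 - x0 0 0| <= 3 * K * etax * t%:R.
Proof.
have step t' : `|(iterate alg f etax etay x0 y0 t'.+1).1 0 0
                 - (iterate alg f etax etay x0 y0 t').1 0 0| <= 3 * K * etax.
  by case: alg; [exact: ogda_step_drift|exact: eg_step_drift].
elim: t => [|t IH].
  have -> : iterate alg f etax etay x0 y0 0 = (x0, y0) by case: alg {step}.
  by rewrite subrr normr0 mulr0.
rewrite -(natr1 t) mulrDr mulr1; apply: le_trans (lerD IH (step t)).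
by apply: le_trans (ler_normD _ _); rewrite [in leRHS]addrC addrA subrK.
Qed.

End Drift.

Lemma lipschitz_derive (h dh : R -> R) K :
  (forall u : R, is_derive u 1 h (dh u)) -> (forall u, `|dh u| <= K) ->
  forall u v, `|h u - h v| <= K * `|u - v|.
Proof.
move=> dhE dh_le u v; wlog vu : u v / v <= u => [IH|].
  by have [/IH//|/ltW/IH] := leP v u; rewrite distrC (distrC v).
have [|w _ ->] := MVT_segment vu (fun w _ => dhE w).
  apply: continuous_subspaceT => w; apply: differentiable_continuous.
  by apply/derivable1_diffP; apply: ex_derive; exact: dhE.
by rewrite normrM ler_wpM2r.
Qed.

(** The slope is 2 eps at 0 and changes at rate at most 4 eps^2 / D, so it needs a distance D / (4
    eps) to drop to eps; a step covers at most 6 eps etax, whence the constant 24. The first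
    smallness condition gives smoothness; the second keeps x_1 on the descending side of 0, where
    Phi is at most Phi(x_0). *)
Lemma hard_instance_sin alg l mu D etax etay eps :
  0 < mu -> mu <= l -> 0 < D -> 0 < etax -> 0 < eps ->
  4 * eps ^+ 2 <= l * D -> 4 * eps ^+ 2 * etax <= D ->
  hard_instance l mu D etax etay eps (D / (24 * eps ^+ 2 * etax)) alg.
Proof.
move=> mu0 mul D0 etax0 eps0 small_l small_etax.
have D_neq0 : D != 0 by rewrite gt_eqF.
have eps_neq0 : eps != 0 by rewrite gt_eqF.
pose om := 2 * eps / D.
have om0 : 0 < om by rewrite divr_gt0 // mulr_gt0 ?ltr0n.
pose g u := D * sin (om * u); pose dg u := 2 * eps * cos (om * u).
have dgE (u : R) : is_derive u 1 g (dg u).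
  have dmul : is_derive u 1 (fun v : R => om * v) om.
    by apply: is_derive_eq; rewrite /GRing.scale /= mulr1.
  have dsin := is_derive1_comp (is_derive_sin (om * u)) dmul.
  have -> : dg u = D *: (cos (om * u) * om).
    by rewrite /GRing.scale /= /dg /om; field.
  exact: is_deriveZ.
have eps2_ge0 : 0 <= 2 * eps by rewrite mulr_ge0 ?ler0n ?ltW.
have dg_le u : `|dg u| <= 2 * eps.
  by rewrite normrM (ger0_norm eps2_ge0) ler_piMr ?cos_max.
have dg_lip u v : `|dg u - dg v| <= 4 * eps ^+ 2 / D * `|u - v|.
  rewrite -mulrBr normrM (ger0_norm eps2_ge0).
  have cos_lip : `|cos (om * u) - cos (om * v)| <= 1 * `|om * u - om * v|.
    apply: (@lipschitz_derive cos (fun w => - sin w)) => w.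
    by rewrite normrN sin_max.
  apply: (@le_trans _ _ (2 * eps * (om * `|u - v|))).
    rewrite ler_pM2l ?mulr_gt0 ?ltr0n //; apply: le_trans cos_lip _.
    by rewrite mul1r -mulrBr normrM (gtr0_norm om0).
  rewrite le_eqVlt; apply/orP; left; apply/eqP; rewrite /om; field.
  by [].
pose z0 : 'rV[R]_1 := const_mx 0.
pose f := coupled R g 0 mu.
have gradE := grad_x_uncoupled _ _ mu dgE.
have dg0 : dg 0 = 2 * eps by rewrite /dg mulr0 cos0 mulr1.
have gminE : g (- (pi / 2 / om)) = - D.
  by rewrite /g mulrN mulrCA divff ?gt_eqF // mulr1 sinN sin_pihalf mulrN1.
have pi2 : 1 <= pi / 2 :> R by have := pi_ge2 R; lra.
(* For EG, s is the relative slope at the half step; it is nonnegative because the phase there lies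
   in [-1, 0], inside [-pi/2, 0]. *)
have [s /andP[s0 s1] x1E] : exists2 s, 0 <= s <= 1 &
    (iterate alg f etax etay z0 z0 1).1 = const_mx (- (2 * eps * etax * s)).
  case: (alg).
    exists 1; first by rewrite ler01 lexx.
    rewrite /= /ogda_step /= gradE /= mxE dg0; apply/rowP => i; rewrite !mxE.
    ring.
  exists (cos (om * (- (2 * eps * etax)))).
    rewrite cos_le1 andbT; apply: cos_ge0_pihalf.
    have -> : om * - (2 * eps * etax) = - (4 * eps ^+ 2 * etax / D).
      by rewrite /om; field.
    have : 4 * eps ^+ 2 * etax / D <= 1 by rewrite ler_pdivrMr // mul1r.
    have : 0 <= 4 * eps ^+ 2 * etax / D.
      by rewrite !mulr_ge0 ?invr_ge0 ?sqr_ge0 ?ler0n ?ltW.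
    by move=> ? ?; apply/andP; split; lra.
  rewrite /= /eg_step !gradE /= !mxE dg0 add0r; apply/rowP => i; rewrite !mxE.
  by rewrite /dg sub0r (mulrC etax (2 * eps)); ring.
exists f, z0, z0 => x; split.
- apply: (smooth_coupled _ _ _ _ _ dgE) => u1 u2 v1 v2.
  rewrite !mul0r addr0 sub0r sqrrN exprMn.
  have l0 : 0 < l by exact: lt_le_trans mul.
  apply: lerD.
    rewrite -exprMn -[leLHS]real_normK ?num_real // -[leRHS]real_normK ?num_real //.
    rewrite ler_sqr ?nnegrE // normrM (gtr0_norm l0).
    apply: le_trans (dg_lip _ _) _.
    by rewrite ler_wpM2r // ler_pdivrMr.
  by rewrite ler_wpM2r ?sqr_ge0 // ler_sqr ?nnegrE ?(ltW mu0) ?(ltW l0).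
- by move=> u; exact: strongly_concave_coupled.
- rewrite {}/x x1E [iterate _ _ _ _ _ _ 0](_ : _ = (z0, z0)); last by case: (alg).
  apply: (is_gap_entry _ _ g (- (pi / 2 / om))) => [v|v|].
  + by rewrite Phi_coupled // expr0n mul0r mul0r addr0.
  + rewrite gminE /g -mulrN1 ler_pM2l //; exact: sin_geN1.
  + rewrite gminE max_r; last first.
      rewrite /g mulr0 sin0 mulr0 mulrN sinN mulrN oppr_le0 mulr_ge0 ?(ltW D0) //.
      apply: sin_ge0_pi; have -> : om * (2 * eps * etax * s) = 4 * eps ^+ 2 * etax / D * s.
        by rewrite /om; field.
      have : 4 * eps ^+ 2 * etax / D <= 1 by rewrite ler_pdivrMr // mul1r.
      have : 0 <= 4 * eps ^+ 2 * etax / D.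
        by rewrite !mulr_ge0 ?invr_ge0 ?sqr_ge0 ?ler0n ?ltW.
      by move=> ? ?; apply/andP; split; nra.
    by rewrite /g mulr0 sin0 mulr0 opprK add0r.
- move=> t; rewrite (grad_Phi_coupled _ _ _ _ _ dgE mu0) enorm1 !mxE.
  rewrite expr0n mul0r mul0r addr0 => le_eps.
  have drift := iterate_drift _ _ mu _ _ etay dgE dg_le etax0 alg z0 z0 t.
  move: drift; rewrite -/f -/(x t) mxE subr0 => drift.
  have := dg_lip 0 (x t 0 0); rewrite dg0 sub0r normrN => lip.
  have eps_le : eps <= 4 * eps ^+ 2 / D * `|x t 0 0|.
    apply: le_trans lip; apply: le_trans (ler_norm _).
    by move: le_eps; rewrite ler_norml => /andP[_]; lra.
  have e2 : 0 < 4 * eps ^+ 2 / D by rewrite divr_gt0 ?mulr_gt0 ?ltr0n ?exprn_gt0.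
  have := le_trans eps_le (ler_wpM2l (ltW e2) drift).
  rewrite ler_pdivrMr; last by rewrite !mulr_gt0 ?ltr0n ?exprn_gt0.
  have -> : 4 * eps ^+ 2 / D * (3 * (2 * eps) * etax * t%:R)
            = eps * (t%:R * (24 * eps ^+ 2 * etax) / D) by field.
  by rewrite ler_pMr // ler_pdivlMr // mul1r.
Qed.

(** * Choice of the instance according to the learning rates *)

Lemma frobenius_bound (a b c l : R) :
  a ^+ 2 + 2 * b ^+ 2 + c ^+ 2 <= l ^+ 2 ->
  forall u v : R, (a * u + b * v) ^+ 2 + (b * u - c * v) ^+ 2
    <= l ^+ 2 * u ^+ 2 + l ^+ 2 * v ^+ 2.
Proof.
move=> abcl u v.
have uv0 : 0 <= u ^+ 2 + v ^+ 2 by rewrite addr_ge0 ?sqr_ge0.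
have := ler_wpM2r uv0 abcl.
(* These squares are the Cauchy-Schwarz defects of the two rows of the Hessian (a, b; b, -c). *)
have := sqr_ge0 (a * v - b * u); have := sqr_ge0 (b * v + c * u).
by move=> ? ? ?; lra.
Qed.

(** The threshold [eps0] is fixed before [N], so below it any iteration bound can be forced. *)
Definition never_stationary (l mu D etax etay : R) alg : Prop :=
  exists2 eps0 : R, 0 < eps0 &
  forall eps N : R, eps < eps0 -> hard_instance l mu D etax etay eps N alg.

Lemma never_stationary_large_etax (l mu D etax etay : R) alg :
  0 < mu -> 0 < D -> 0 < etax -> 0 < etay ->
  mu <= l -> 2 <= l * etax ->
  never_stationary l mu D etax etay alg.
Proof.
move=> mu0 D0 etax0 etay0 mul le_etax.
have a0 : 0 < 2 / etax by rewrite divr_gt0 ?ltr0n.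
(* On the line y = 0 the curvature 2 / etax, at most l, gives the eigenvalue 2: plain gradient
   descent would merely oscillate. *)
apply: (@hard_instance_ray (2 / etax) 0 mu 0 2) => //.
- by rewrite mul0r addr0 mulrC divfK ?gt_eqF.
- by rewrite mulr0 subrr !mulr0.
- by right.
- by rewrite expr0n mul0r addr0.
have al : 2 / etax <= l by rewrite ler_pdivrMr.
move: (2 / etax) a0 al => a a0 al u v; rewrite !mul0r addr0 sub0r sqrrN !exprMn.
have l0 : 0 < l by exact: lt_le_trans al.
have [a_ge0 mu_ge0 l_ge0] := And3 (ltW a0) (ltW mu0) (ltW l0).
by apply: lerD; rewrite ler_wpM2r ?sqr_ge0 // ler_sqr ?nnegrE.
Qed.

(* For a vanishing coupling the update matrix has an eigenvalue close to
   [etay * l / 2 > 2]: the dual variable overshoots and drags [x] along.  The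
   coupling is [d * q], with [d] small. *)
Lemma never_stationary_large_etay (l mu D etax etay : R) alg :
  0 < mu -> 0 < D -> 0 < etax -> 0 < etay ->
  4 * mu <= l -> 4 < l * etay ->
  never_stationary l mu D etax etay alg.
Proof.
move=> mu0 D0 etax0 etay0 mul lt_etay.
have l0 : 0 < l by lra.
(* The first bound ensures lam >= 2, the second that the squared coupling d lam / etax is at most
   l^2 / 4. *)
pose d := Num.min (l / 2 - 2 / etay) (l * etax / (2 * etay)).
have d0 : 0 < d.
  rewrite lt_min !divr_gt0 ?mulr_gt0 ?ltr0n // andbT subr_gt0.
  by rewrite ltr_pdivrMr //; lra.
have dl : d <= l / 2 - 2 / etay by rewrite ge_min lexx.
have ds : d * (2 * etay) <= l * etax.
  by rewrite -ler_pdivlMr ?mulr_gt0 ?ltr0n // ge_min lexx orbT.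
pose lam := etay * (l / 2 - d).
have lam2 : 2 <= lam by rewrite /lam mulrC -ler_pdivrMr //; lra.
have lam0 : 0 < lam by apply: lt_le_trans lam2.
(* Solves the first eigenvector equation etax d q^2 = lam. *)
pose q := Num.sqrt (lam / (etax * d)).
have lam_etaxd : 0 < lam / (etax * d) by apply: divr_gt0 => //; exact: mulr_gt0.
have q2 : q ^+ 2 = lam / (etax * d) by rewrite sqr_sqrtr // ltW.
have b2 : (d * q) ^+ 2 = d * lam / etax.
  by rewrite exprMn q2; field; rewrite !gt_eqF.
have b2_gt0 : 0 < (d * q) ^+ 2 by rewrite b2; apply: divr_gt0 => //; exact: mulr_gt0.
apply: (@hard_instance_ray 0 (d * q) (l / 2) q lam) => //.
- rewrite add0r -mulrA -expr2 q2; field; by rewrite !gt_eqF.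
- by rewrite /lam; ring.
- by right.
- by lra.
- by rewrite add0r divr_gt0 // divr_gt0 // ltr0n.
apply: frobenius_bound.
have b2_le : (d * q) ^+ 2 <= l ^+ 2 / 4.
  by rewrite b2 ler_pdivrMr // /lam; nra.
have := exprn_gt0 2 l0; rewrite expr0n /=; lra.
Qed.

(* [f] is concave in [x], and only a fast dual variable could stabilize this:
   here the update matrix has the double eigenvalue [- mu * etay / 2]. *)
Lemma never_stationary_small_etay (l mu D etax etay : R) alg :
  0 < mu -> 0 < D -> 0 < etax -> 0 < etay ->
  4 * mu <= l -> 4 * mu * etay <= l * etax ->
  never_stationary l mu D etax etay alg.
Proof.
move=> mu0 D0 etax0 etay0 mul le_etay.
have l0 : 0 < l by lra.
pose s := etay / etax.
have s0 : 0 < s by rewrite divr_gt0.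
have mus : mu * s <= l / 4.
  by rewrite /s mulrA ler_pdivrMr //; lra.
pose q := Num.sqrt s.
have q2 : q ^+ 2 = s by rewrite sqr_sqrtr // ltW.
have b2 : (3 / 2 * mu * q) ^+ 2 = 9 / 4 * mu * (mu * s).
  by rewrite exprMn q2; field.
(* With these f_xx and f_yy, convexity of Phi requires b^2 > 2 mu^2 s and real eigenvalues require
   b^2 <= 9/4 mu^2 s; the coupling takes the upper limit. *)
apply: (@hard_instance_ray (- (2 * mu * s)) (3 / 2 * mu * q) mu q (- (mu * etay / 2)))
  => //.
- rewrite -(mulrA _ q q) -expr2 q2 /s; field; by rewrite gt_eqF.
- by field.
- by left; rewrite oppr_lt0 divr_gt0 ?mulr_gt0 ?ltr0n.
- rewrite b2; have -> : - (2 * mu * s) + 9 / 4 * mu * (mu * s) / mu = mu * s / 4.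
    by field; rewrite gt_eqF.
  by apply: divr_gt0; [exact: mulr_gt0|rewrite ltr0n].
apply: frobenius_bound; rewrite b2 sqrrN.
have mus0 : 0 < mu * s by rewrite mulr_gt0.
by nra.
Qed.

Lemma slow_small_etax (l mu D etax etay : R) alg :
  0 < mu -> 0 < D -> 0 < etax -> 0 < etay ->
  mu <= l -> l ^+ 2 * etax <= 16 * mu ->
  exists2 eps0 : R, 0 < eps0 & forall eps, 0 < eps -> eps < eps0 ->
  hard_instance l mu D etax etay eps (l / 384 * (l / mu * D / eps ^+ 2)) alg.
Proof.
move=> mu0 D0 etax0 etay0 mul le_etax.
have l0 : 0 < l by exact: lt_le_trans mul.
(* For eps < 1 one has eps^2 <= eps, so thresholds linear in eps imply the quadratic smallness
   conditions. *)
exists (Num.min 1 (Num.min (l * D / 4) (D / (4 * etax)))).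
  by rewrite !lt_min ltr01 !divr_gt0 ?mulr_gt0 ?ltr0n.
move=> eps eps0; rewrite !lt_min => /and3P[eps1 epsl epsx].
have eps2 : eps ^+ 2 <= eps by rewrite expr2 ler_piMl ?ltW.
have le_N : l / 384 * (l / mu * D / eps ^+ 2) <= D / (24 * eps ^+ 2 * etax).
  (* Here 384 = 16 * 24: the bound on etax times the drift constant. *)
  have -> : l / 384 * (l / mu * D / eps ^+ 2)
          = l ^+ 2 * etax / (16 * mu) * (D / (24 * eps ^+ 2 * etax)).
    by field; rewrite !gt_eqF.
  rewrite ler_piMl ?ler_pdivrMr ?mul1r ?mulr_gt0 ?ltr0n //.
  by rewrite ltW // divr_gt0 // !mulr_gt0 ?exprn_gt0 ?ltr0n.
have [f [x0 [y0 [fs fc fg fN]]]] : hard_instance l mu D etax etay eps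
    (D / (24 * eps ^+ 2 * etax)) alg.
  apply: hard_instance_sin => //; first by lra.
  rewrite ltr_pdivlMr ?mulr_gt0 ?ltr0n // in epsx; nra.
by exists f, x0, y0; split => // t /fN; exact: le_trans.
Qed.

Lemma hard_instance_exists (l mu D etax etay : R) alg :
  0 < mu -> 0 < D -> 0 < etax -> 0 < etay -> mu <= l ->
  exists2 eps0 : R, 0 < eps0 & forall eps, 0 < eps -> eps < eps0 ->
  hard_instance l mu D etax etay eps (l / 384 * (l / mu * D / eps ^+ 2)) alg.
Proof.
move=> mu0 D0 etax0 etay0 mul.
have weaken : never_stationary l mu D etax etay alg -> exists2 eps0 : R, 0 < eps0 &
    forall eps, 0 < eps -> eps < eps0 ->
    hard_instance l mu D etax etay eps (l / 384 * (l / mu * D / eps ^+ 2)) alg.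
  by move=> [e e0 He]; exists e => // eps _; exact: He.
have l0 : 0 < l by exact: lt_le_trans mul.
have [mul4|mul4] := leP (4 * mu) l.
  have [|etay_le] := ltP 4 (l * etay).
    by move=> ?; exact/weaken/never_stationary_large_etay.
  have [|etax_lt] := leP (4 * mu * etay) (l * etax).
    by move=> ?; exact/weaken/never_stationary_small_etay.
  (* Chaining the failed cases: l^2 etax < 4 mu (l etay) <= 16 mu. *)
  apply: slow_small_etax => //; nra.
have [|etax_lt] := leP 2 (l * etax).
  by move=> ?; exact/weaken/never_stationary_large_etax.
(* For kappa < 4: l^2 etax < 2 l < 8 mu. *)
apply: slow_small_etax => //; nra.
Qed.

End LowerBound.

Theorem theorem5p2 (R : realType) (l : R) (hl : 0 < l) :
  exists2 c : R, 0 < c &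
  forall mu : R, 0 < mu -> mu <= l ->
  forall Delta : R, 0 < Delta ->
  forall (alg : method) (etax etay : R), 0 < etax -> 0 < etay ->
  exists2 eps0 : R, 0 < eps0 &
  forall eps : R, 0 < eps -> eps < eps0 ->
  exists (m n : nat) (f : 'rV[R]_m.+1 -> 'rV[R]_n.+1 -> R)
         (x0 : 'rV[R]_m.+1) (y0 : 'rV[R]_n.+1),
    let kappa := l / mu in
    let x := fun t : nat => (iterate alg f etax etay x0 y0 t).1 in
    [/\ smooth l f,
        forall u : 'rV[R]_m.+1, strongly_concave mu (f u),
        is_gap (Phi f) (x 0%N) (x 1%N) Delta &
        forall (T : nat) (xbar : 'rV[R]_m.+1),
          returned x T xbar ->
          enorm (grad (Phi f) xbar) <= eps ->
          c * (kappa * Delta / eps ^+ 2) <= T%:R].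
Proof.
exists (l / 384) => [|mu mu0 mul D D0 alg etax etay etax0 etay0].
  by rewrite divr_gt0 ?ltr0n.
have [eps0 eps0_gt0 hard] :=
  hard_instance_exists R l mu D etax etay alg mu0 D0 etax0 etay0 mul.
exists eps0 => // eps eps_gt0 /(hard _ eps_gt0) [f [x0 [y0 [fs fc fg fN]]]].
(* Both dimensions are one. Any outcome is some x_t with t <= T, so the bound on t passes to T. *)
exists 0%N, 0%N, f, x0, y0; split => // T xbar [t /andP[_ tT] ->] /fN.
by move=> /le_trans; apply; rewrite ler_nat.
Qed.
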